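(* Let $R$ be a unitary ring. Let $a\in R$ and let $d\in R$ be regular, such that $a$ is invertible along $d$. Let $d^-$ be an inner inverse of $d$, let $p=dd^-$, and let $w$ be the inverse of $dap$ in the subring $pRp$. For $t\in R$, the element $da+t(da)^\pi$ is invertible in $R$ if and only if $-(1-p)twda(1-p)+(1-p)t(1-p)$ is invertible in the subring $(1-p)R(1-p)$. Moreover, in this situation, $$a^{\parallel d} = (da+t (da)^\pi)^{-1}d.$$
   Context: An element $d$ of a unitary ring $R$ is regular if there is $d^-\in R$ with $d=dd^-d$; such $d^-$ is called an inner inverse of $d$. For an idempotent $p$, $pRp$ is a ring with unity $p$. For $a,d\in R$, $a$ is invertible along $d$ if there exists $b\in R$ such that $bab=b$, $bR=dR$ and $Rb=Rd$. Such $b$ is unique when it exists and is denoted $a^{\parallel d}$. It is known that if $a$ is invertible along $d$ and $p=dd^-$, then $dap$ is invertible in $pRp$ and $da$ is group invertible. An element $x$ is group invertible if there is $x^\#\in R$ (necessarily unique) with $xx^\#x=x$, $x^\#xx^\#=x^\#$, $xx^\#=x^\#x$; then its spectral idempotent is $x^\pi=1-xx^\#$. *)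

(* Defs.v *)
From HB Require Import structures.
From mathcomp Require Import all_boot all_order all_algebra.
From mathcomp Require Import boolp classical_sets.

Set Implicit Arguments.
Unset Strict Implicit.
Unset Printing Implicit Defensive.

Import GRing.Theory.

Local Open Scope classical_set_scope.
Local Open Scope ring_scope.

Section RingNotions.
Variable R : pzRingType.
Implicit Types a b d p x y : R.

Definition inner_inverse d y := d = d * y * d.

Definition regular d := exists y, inner_inverse d y.

Definition is_inverse x y := x * y = 1 /\ y * x = 1.

Definition invertible x := exists y, is_inverse x y.

(* The operators [inverse], [inverse_along] and [group_inverse] are total:
   they take the junk value 0 when no inverse of the given kind exists. *)
Definition inverse x : R := xget 0 [set y | is_inverse x y].

Definition right_ideal x : set R := range (fun y => x * y).

Definition left_ideal x : set R := range (fun y => y * x).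

Definition is_inverse_along a d b :=
  [/\ b * a * b = b, right_ideal b = right_ideal d
    & left_ideal b = left_ideal d].

Definition invertible_along a d := exists b, is_inverse_along a d b.

Definition inverse_along a d : R := xget 0 [set b | is_inverse_along a d b].

Definition is_group_inverse x y :=
  [/\ x * y * x = x, y * x * y = y & x * y = y * x].

Definition group_inverse x : R := xget 0 [set y | is_group_inverse x y].

Definition spectral_idempotent x : R := 1 - x * group_inverse x.

Definition corner p : set R := range (fun x => p * x * p).

(* For idempotent p: y is the inverse of x in the ring [corner p], whose
   unity is p. *)
Definition is_corner_inverse p x y :=
  [/\ corner p x, corner p y, x * y = p & y * x = p].

Definition corner_invertible p x := exists y, is_corner_inverse p x y.

End RingNotions.

(* Main.v *)
Require Import Defs.
From mathcomp Require Import all_boot all_order all_algebra.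
From mathcomp Require Import boolp classical_sets.

(** Put [x = da] and [q = 1 - p]. Since [px = x], the group inverse of [x] is
    [w^2 x], so [x^pi = 1 - wx = vq] with [v = 1 - wxq]. As [qw = 0], [v] is a
    unit; since [xv = xp] and [qv = q], [(x + t x^pi) v = xp + tvq], which is
    upper triangular in the Peirce decomposition of [p], with diagonal entries
    [xp] (invertible in [pRp]) and [qtvq = -qtwxq + qtq]. Moreover
    [a^{||d} = wd], and [(x + t x^pi) wd = d] because [x^pi w = 0]. *)

Import GRing.Theory.
Local Open Scope ring_scope.

Section RingInverses.
Variable R : pzRingType.
Implicit Types a b d p s u v w x y : R.

Lemma inverse_eq x y : is_inverse x y -> inverse x = y.
Proof.
move=> [xy yx]; apply: xget_unique => // z [xz zx].
by rewrite -[z]mul1r -yx -mulrA xz mulr1.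
Qed.

(** For two group inverses [y] and [z], commutation gives [x * z = y * x * z * x = y * x = x * y],
    whence [z = z * x * z = z * x * y = x * y * y = y]. *)
Lemma group_inverse_eq x y : is_group_inverse x y -> group_inverse x = y.
Proof.
move=> Hy; apply: xget_unique => // z [xzx zxz xz].
have [xyx yxy xy] := Hy.
have xyz : x * z = x * y.
  by rewrite -{1}xyx -mulrA xz xy -mulrA (mulrA x z) xzx.
by rewrite -zxz -mulrA xyz mulrA -xz xyz xy.
Qed.

(** Two inverses [b] and [c] along [d] both equal [c * a * b]: write [c = l * b] and absorb
    [b * a * b = b], then [b = c * k] and absorb [c * a * c = c]. *)
Lemma inverse_along_eq a d b : is_inverse_along a d b -> inverse_along a d = b.
Proof.
move=> Hb; apply: xget_unique => // c [cac cR Rc].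
have [bab bR Rb] := Hb.
have [k _ ck] : right_ideal c b by rewrite cR -bR; exists 1; rewrite ?mulr1.
have [l _ lb] : left_ideal b c by rewrite Rb -Rc; exists 1; rewrite ?mul1r.
by rewrite -lb -[in RHS]ck -{1}bab !mulrA lb -[in RHS]cac -!mulrA ck.
Qed.

Lemma invertible_mulr u v : invertible v -> invertible (u * v) <-> invertible u.
Proof.
move=> [v' [vv' v'v]]; split=> -[y [y1 y2]].
  exists (v * y); split; first by rewrite mulrA.
  by rewrite -[u]mulr1 -vv' (mulrA u) !mulrA -(mulrA v) -(mulrA v) -(mulrA y)
    y2 mulr1 vv'.
exists (v' * y); split.
  by rewrite -mulrA (mulrA v) vv' mul1r.
by rewrite -mulrA (mulrA y) y2 mul1r.
Qed.

Lemma corner_unity p x : p * p = p -> corner p x -> p * x = x /\ x * p = x.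
Proof.
by move=> pp [y _ <-]; split; rewrite ?mulrA ?pp // -!mulrA pp.
Qed.

Lemma idempotent_compl p : p * p = p ->
  [/\ (1 - p) * (1 - p) = 1 - p, p * (1 - p) = 0 & (1 - p) * p = 0].
Proof.
by move=> pp; rewrite mulrBr !mulrBl mulr1 !mul1r mulrBr mulr1 pp subrr subr0.
Qed.

(** In Peirce blocks, [y + s * (1 - p)] is upper triangular with diagonal [y] and
    [(1 - p) * s * (1 - p)]. As [y] is invertible in its corner, only the second block matters. *)
Lemma triangular_invertible p y w s : p * p = p -> is_corner_inverse p y w ->
  invertible (y + s * (1 - p)) <->
  corner_invertible (1 - p) ((1 - p) * s * (1 - p)).
Proof.
move=> pp [cy cw yw wy].
have [py yp] := corner_unity p y pp cy.
have [pw wp] := corner_unity p w pp cw.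
have [] := idempotent_compl p pp.
have : p + (1 - p) = 1 by rewrite addrC subrK.
move: (1 - p) => q pq qq pq0 qp0.
have qy : q * y = 0 by rewrite -py mulrA qp0 mul0r.
have yq : y * q = 0 by rewrite -yp -mulrA pq0 mulr0.
have qw : q * w = 0 by rewrite -pw mulrA qp0 mul0r.
split=> [[n [Mn nM]]|[z [_ cz sz zs]]].
(* The inverse [n] is triangular too: [n * p = w] gives [q * n * p = q * w = 0]. Hence its block
   [q * n * q] inverts [q * s * q]. *)
- have np : n * p = w.
    have <- : (y + s * q) * w = p by rewrite mulrDl yw -mulrA qw mulr0 addr0.
    by rewrite mulrA nM mul1r.
  exists (q * n * q); split; [by exists s|by exists n| |].
    transitivity (q * ((y + s * q) * n) * q); last by rewrite Mn mulr1.
    by rewrite (mulrA q (_ + _)) mulrDr qy add0r !mulrA -(mulrA _ q q) qq.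
  transitivity (q * (n * (y + s * q)) * q); last by rewrite nM mulr1.
  transitivity (q * n * q * (s * q)).
    by rewrite !mulrA -(mulrA _ q q) qq.
  transitivity (q * n * (s * q)).
    by rewrite -[in RHS](mulr1 (q * n)) -pq mulrDr -(mulrA q n p) np qw add0r.
  by rewrite (mulrA q n) -(mulrA _ (_ + _)) mulrDl yq add0r -(mulrA s) qq.
- have [qz zq] := corner_unity q z qq cz.
  have yz : y * z = 0 by rewrite -qz mulrA yq mul0r.
  have zy : z * y = 0 by rewrite -zq -mulrA qy mulr0.
  have {}sz : q * (s * z) = q by rewrite -qz !mulrA.
  have {}zs : z * s * q = q by rewrite -[RHS]zs !mulrA zq.
  (* The inverse of a 2 by 2 triangular block matrix, with [- w * s * z] as its off-diagonal
     entry. *)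
  exists (w + z - w * s * z); split.
    have sz_split : s * z = p * (s * z) + q.
      by rewrite -[X in _ + X]sz -mulrDl pq mul1r.
    rewrite mulrDl !(mulrBr, mulrDr) yw yz addr0 !mulrA yw -(mulrA s q w) qw.
    rewrite mulr0 !mul0r add0r subr0 -(mulrA s) qz -(mulrA p).
    by rewrite {2}sz_split addrA subrK.
  rewrite mulrDr !mulrBl !mulrDl wy zy addr0 -(mulrA (w * s)) zy mulr0 subr0.
  by rewrite (mulrA z) zs -(mulrA (w * s)) (mulrA z) zs -(mulrA w s q)
    (addrC _ q) addrK.
Qed.

End RingInverses.

Theorem theorem4p2 (R : pzRingType) (a d dm p w : R)
  (d_regular : regular d)
  (a_invertible_along_d : invertible_along a d)
  (dm_inner : inner_inverse d dm)
  (p_def : p = d * dm)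
  (w_inverse : is_corner_inverse p (d * a * p) w)
  (t : R) :
  (invertible (d * a + t * spectral_idempotent (d * a)) <->
   corner_invertible (1 - p)
     (- ((1 - p) * t * w * d * a * (1 - p)) + (1 - p) * t * (1 - p))) /\
  (invertible (d * a + t * spectral_idempotent (d * a)) ->
   inverse_along a d = inverse (d * a + t * spectral_idempotent (d * a)) * d).
Proof.
have pd : p * d = d by rewrite p_def -dm_inner.
have pp : p * p = p by rewrite {2}p_def mulrA pd.
have [_ cw xw wx] := w_inverse.
have [pw wp] := corner_unity _ p w pp cw.
have [qq pq qp] := idempotent_compl _ p pp.
set x := d * a in w_inverse xw wx *.
have xE : x = d * a by [].
clearbody x.
have px : p * x = x by rewrite xE mulrA pd.
have {}xw : x * w = p by rewrite -pw mulrA.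
have wxw : w * x * w = w by rewrite -mulrA xw.
(* Here [wx] only says [w * (x * p) = p], so the missing [p] is supplied by [x = p * x]. *)
have wxx : w * x * x = x by rewrite -[in X in _ * X]px mulrA -(mulrA w) wx.
have xpi : spectral_idempotent x = 1 - w * x.
  rewrite /spectral_idempotent (group_inverse_eq _ x (w * w * x)).
    by rewrite !mulrA xw pw.
  have e : x * (w * w * x) = w * x by rewrite !mulrA xw pw.
  split; first by rewrite e.
    by rewrite -mulrA e !mulrA -(mulrA _ x w) xw -(mulrA w w p) wp.
  by rewrite e -!mulrA (mulrA w x x) wxx.
rewrite xpi; split.
- set v := 1 - w * x * (1 - p).
  have qw : (1 - p) * w = 0 by rewrite -pw mulrA qp mul0r.
  have qv : (1 - p) * v = 1 - p by rewrite mulrBr mulr1 !mulrA qw !mul0r subr0.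
  (* Square zero makes [1 - w * x * (1 - p)] and [1 + w * x * (1 - p)] mutually inverse. *)
  have nil : w * x * (1 - p) * (w * x * (1 - p)) = 0.
    by rewrite -(mulrA (w * x)) !(mulrA (1 - p)) qw !mul0r mulr0.
  have v_unit : invertible v.
    exists (1 + w * x * (1 - p)); split.
      by rewrite mulrDr mulr1 mulrBl mul1r nil subr0 subrK.
    by rewrite mulrBr mulr1 mulrDl mul1r nil addr0 addrK.
  have xv : x * v = x * p.
    by rewrite mulrBr mulr1 !mulrA xw px mulrBr mulr1 subKr.
  (* The two sides agree because [w * x * p = p]. *)
  have vq : 1 - w * x = v * (1 - p).
    rewrite mulrBl mul1r -(mulrA (w * x)) qq mulrBr mulr1 -(mulrA w x) wx.
    by rewrite opprB addrA subrK.
  have uv : (x + t * (1 - w * x)) * v = x * p + t * v * (1 - p).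
    by rewrite mulrDl xv vq -!mulrA qv.
  rewrite -(invertible_mulr _ _ v v_unit) uv.
  rewrite (triangular_invertible _ p (x * p) w (t * v) pp w_inverse).
  suff -> : (1 - p) * (t * v) * (1 - p) =
      - ((1 - p) * t * w * d * a * (1 - p)) + (1 - p) * t * (1 - p) by [].
  have -> : (1 - p) * (t * v) * (1 - p) = (1 - p) * t * (v * (1 - p)).
    by rewrite !mulrA.
  by rewrite [v * _]mulrBl mul1r -(mulrA (w * x)) qq mulrBr addrC xE !mulrA.
- move=> [y Hy]; rewrite (inverse_eq _ _ y Hy).
  have uwd : (x + t * (1 - w * x)) * (w * d) = d.
    by rewrite mulrA mulrDl xw -mulrA mulrBl mul1r wxw subrr mulr0 addr0.
  have -> : y * d = w * d by rewrite -{1}uwd mulrA Hy.2 mul1r.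
  (* From [d = p * d = w * (x * p) * d]; this puts [d] in the right ideal of [w * d]. *)
  have dE : d = w * d * (a * d).
    by rewrite -{1}pd -wx -!mulrA pd xE -mulrA.
  apply: inverse_along_eq; split.
  + by rewrite -(mulrA w d a) -xE mulrA wxw.
  + apply/seteqP; split=> _ [z _ <-].
      (* The witness comes from [w = p * w = d * dm * w]. *)
      by exists (dm * w * d * z) => //; rewrite !mulrA -p_def pw.
    by exists (a * d * z) => //; rewrite mulrA -dE.
  + apply/seteqP; split=> _ [z _ <-].
      by exists (z * w) => //; rewrite mulrA.
    (* Here [d = p * d = x * (w * d)]. *)
    by exists (z * x) => //; rewrite -mulrA (mulrA x) xw pd.
Qed.
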